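(* The Chabauty closure $\overline{\mathcal D_n}$ of the set of diagonal orthogonal groups in $\mathrm{GL}(n;\mathbb R)$ is homeomorphic to the maximal De Concini–Procesi wonderful compactification of the coordinate hyperplane arrangement in $\mathbb{RP}^{n-1}$.
   Context: For a Lie group $G$, $\mathfrak C(G)$ denotes the space of closed subgroups of $G$ with the Chabauty topology. For nondegenerate symmetric $J$ put $\mathrm O(J)=\{A\in\mathrm{GL}(n;\mathbb R): A^TJA=J\}$. Let $\mathcal D_n=\{\mathrm O(D): D\in\mathrm{GL}(n;\mathbb R)\text{ diagonal}\}\subset\mathfrak C(\mathrm{GL}(n;\mathbb R))$, with closure $\overline{\mathcal D_n}$ in $\mathfrak C(\mathrm{GL}(n;\mathbb R))$. Maximal wonderful compactification: let $V=\mathbb R^n$ and let $\mathcal A$ be the arrangement of coordinate hyperplanes $\{x_i=0\}$. Let $\mathcal L$ be the set of all intersections of members of $\mathcal A$ with nonempty projectivization, i.e. the subspaces $X_I=\{x_i=0 \text{ for all } i\in I\}$ for nonempty proper subsets $I\subsetneq\{1,\dots,n\}$. The natural projections $V\to V/X$ induce a map $$F\colon \mathbb P(V)\smallsetminus\mathbb P(\mathcal A)\longrightarrow\prod_{X\in\mathcal L}\mathbb P(V/X).$$ The maximal De Concini–Procesi wonderful compactification is the closure of the graph of $F$ in $\mathbb P(V)\times\prod_{X\in\mathcal L}\mathbb P(V/X)$. (Equivalently it is obtained from $\mathbb P(V)$ by successively blowing up the proper transforms of the elements of $\mathbb P(\mathcal L)$ in order of increasing dimension.) *)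

(* Defs.v *)
From HB Require Import structures.
From mathcomp Require Import all_boot all_order all_algebra.
From mathcomp Require Import all_classical all_reals all_analysis.

Set Implicit Arguments.
Unset Strict Implicit.
Unset Printing Implicit Defensive.

Import Order.TTheory GRing.Theory Num.Theory.
Import numFieldNormedType.Exports.

Local Open Scope classical_set_scope.
Local Open Scope ring_scope.
Local Open Scope quotient_scope.

Definition homeomorphic (X Y : topologicalType) : Prop :=
  exists (f : X -> Y) (g : Y -> X),
    [/\ cancel f g, cancel g f, continuous f & continuous g].

(* No compatibility between the group law and the topology is required here:
   the Chabauty topology makes sense without it. *)
#[short(type="groupTopType")]
HB.structure Definition GroupTop := {G of Group G & Topological G}.

Section Chabauty.
Variable G : groupTopType.

Definition is_closed_subgroup (H : set G) : Prop :=
  [/\ closed H, H 1%g, (forall x y, H x -> H y -> H (x * y)%g)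
    & (forall x, H x -> H x^-1%g)].

Definition closed_subgroup : Type :=
  set_type [set H : set G | is_closed_subgroup H].

HB.instance Definition _ := Choice.on closed_subgroup.

Definition carrier (H : closed_subgroup) : set G := set_val H.

(* Subbasic open sets: the closed subgroups missing a given compact set, and
   those meeting a given open set. *)
Definition chabauty_subbase : set (set closed_subgroup) :=
  [set O | exists2 K : set G, compact K &
     O = [set H | carrier H `&` K = set0]] `|`
  [set O | exists2 U : set G, open U &
     O = [set H | carrier H `&` U !=set0]].

HB.instance Definition _ :=
  @isSubBaseTopological.Build closed_subgroup (set closed_subgroup)
    chabauty_subbase id.

End Chabauty.

Section GeneralLinear.
Variables (R : realType) (n : nat).

Definition GLn : Type := set_type [set A : 'M[R]_n | A \in unitmx].

HB.instance Definition _ := Topological.on GLn.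

Lemma GLn_unit (A : GLn) : set_val A \in unitmx.
Proof. exact: (set_valP A). Qed.

Lemma GLn_one_subproof : [set A : 'M[R]_n | A \in unitmx] 1%:M.
Proof. exact: unitmx1. Qed.

Lemma GLn_inv_subproof (A : GLn) :
  [set A : 'M[R]_n | A \in unitmx] (invmx (set_val A)).
Proof. by rewrite /= unitmx_inv GLn_unit. Qed.

Lemma GLn_mul_subproof (A B : GLn) :
  [set A : 'M[R]_n | A \in unitmx] (set_val A *m set_val B).
Proof. by rewrite /= unitmx_mul !GLn_unit. Qed.

Definition GLn_one : GLn := SigSub (mem_set GLn_one_subproof).
Definition GLn_inv (A : GLn) : GLn := SigSub (mem_set (GLn_inv_subproof A)).
Definition GLn_mul (A B : GLn) : GLn :=
  SigSub (mem_set (GLn_mul_subproof A B)).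

Lemma GLn_mulA : associative GLn_mul.
Proof. by move=> A B C; apply: val_inj; rewrite /= mulmxA. Qed.

Lemma GLn_mul1 : left_id GLn_one GLn_mul.
Proof. by move=> A; apply: val_inj; rewrite /= mul1mx. Qed.

Lemma GLn_mulr1 : right_id GLn_one GLn_mul.
Proof. by move=> A; apply: val_inj; rewrite /= mulmx1. Qed.

Lemma GLn_mulV : left_inverse GLn_one GLn_inv GLn_mul.
Proof. by move=> A; apply: val_inj; rewrite /= mulVmx ?GLn_unit. Qed.

Lemma GLn_mulrV : right_inverse GLn_one GLn_inv GLn_mul.
Proof. by move=> A; apply: val_inj; rewrite /= mulmxV ?GLn_unit. Qed.

HB.instance Definition _ := isGroup.Build GLn
  GLn_mulA GLn_mul1 GLn_mulr1 GLn_mulV GLn_mulrV.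

Definition orthogonal (J : 'M[R]_n) : set GLn :=
  [set A | (set_val A)^T *m J *m set_val A = J].

Lemma orthogonal_closed_subgroup (J : 'M[R]_n) :
  is_closed_subgroup (orthogonal J).
Proof.
split.
- rewrite (_ : orthogonal J = \bigcap_(ij : 'I_n * 'I_n)
      ((fun A : GLn => ((set_val A)^T *m J *m set_val A) ij.1 ij.2) @^-1`
         [set J ij.1 ij.2])); last first.
    apply/seteqP; split=> A /= AJ; first by move=> ij _ /=; rewrite AJ.
    by apply/matrixP => i j; exact: (AJ (i, j)).
  apply: closed_bigI => -[i j] _ /=.
  apply: (@closed_comp GLn R) => [A _|]; last exact: closed_eq.
  move: A; rewrite -/(continuous _).
  have cv (k l : 'I_n) : continuous (fun B : GLn => set_val B k l).
    move=> A; apply: (@continuous_comp _ _ _ set_val (fun M : 'M[R]_n => M k l)).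
      exact: initial_continuous.
    exact: coord_continuous.
  rewrite (_ : (fun B : GLn => _) = (fun B : GLn =>
      \sum_k (\sum_l set_val B l i * J l k) * set_val B k j)); last first.
    apply/funext => B; rewrite mxE; apply: eq_bigr => k _; rewrite mxE.
    by congr (_ * _); apply: eq_bigr => l _; rewrite mxE.
  apply: continuous_big => [|k _]; first exact: add_continuous.
  have c1 : continuous (fun B : GLn => \sum_l set_val B l i * J l k).
    apply: continuous_big => [|l _]; first exact: add_continuous.
    by move=> A; apply: (@continuousM R GLn); [exact: cv|exact: cst_continuous].
  by move=> A; apply: (@continuousM R GLn); [exact: c1|exact: cv].
- by rewrite /orthogonal /= trmx1 mul1mx mulmx1.
- move=> A B; rewrite /orthogonal /= => AJ BJ.
  by rewrite trmx_mul -!mulmxA (mulmxA _ J) (mulmxA _ (set_val A)) AJ mulmxA.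
- move=> A; rewrite /orthogonal /= => AJ.
  rewrite -{1}AJ !mulmxA -trmx_mul mulmxV ?GLn_unit// trmx1 mul1mx.
  by rewrite -mulmxA mulmxV ?GLn_unit// mulmx1.
Qed.

Definition orthogonal_group (J : 'M[R]_n) : closed_subgroup GLn :=
  SigSub (mem_set (orthogonal_closed_subgroup J)).

Definition diag_orthogonal_groups : set (closed_subgroup GLn) :=
  [set orthogonal_group (set_val D) | D in
    [set D : GLn | is_diag_mx (set_val D)]].

End GeneralLinear.

Section ProjectiveQuotient.
Variables (R : realType) (n : nat).
Local Notation V := 'rV[R]_n.
Implicit Types (X : {vspace V}).

(* The projective space P(V/X).  The nonzero classes of V/X are those of the
   vectors outside X, and v, w outside X span the same line of V/X when
   v = c w mod X for some scalar c != 0; so P(V/X) is the quotient of V \ X,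
   with the quotient topology, by that relation.  P(V) is P(V/0). *)
Definition off_subspace X : set V := [set v | v \notin X].

Definition same_line X (v w : off_subspace X) : bool :=
  `[< exists2 c : R, c != 0 & set_val v - c *: set_val w \in X >].

Lemma same_line_refl X : reflexive (@same_line X).
Proof.
by move=> v; apply/asboolP; exists 1; rewrite ?oner_neq0// scale1r subrr mem0v.
Qed.

Lemma same_line_sym X : symmetric (@same_line X).
Proof.
have H v w : @same_line X v w -> @same_line X w v.
  move=> /asboolP[c c0 vw]; apply/asboolP; exists c^-1; rewrite ?invr_eq0//.
  have -> : set_val w - c^-1 *: set_val v =
      - c^-1 *: (set_val v - c *: set_val w).
    by rewrite scalerBr !scaleNr scalerA mulVf// scale1r opprK addrC.
  exact: memvZ.
by move=> v w; apply/idP/idP; exact: H.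
Qed.

Lemma same_line_trans X : transitive (@same_line X).
Proof.
move=> v u w /asboolP[c c0 uv] /asboolP[d d0 vw]; apply/asboolP.
exists (c * d); rewrite ?mulf_neq0//.
have -> : set_val u - (c * d) *: set_val w =
    (set_val u - c *: set_val v) + c *: (set_val v - d *: set_val w).
  by rewrite scalerBr scalerA addrA subrK.
by apply: memvD => //; apply: memvZ.
Qed.

Canonical same_line_equiv X :=
  EquivRel (@same_line X) (@same_line_refl X) (@same_line_sym X)
    (@same_line_trans X).

Definition proj_quot X : Type := quotient_topology {eq_quot same_line_equiv X}.

HB.instance Definition _ X := Topological.on (proj_quot X).
HB.instance Definition _ X := Quotient.on (proj_quot X).

Definition line X (v : off_subspace X) : proj_quot X := \pi_(proj_quot X) v.

Lemma lineP X (v w : off_subspace X) :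
  line v = line w <->
  exists2 c : R, c != 0 & set_val v - c *: set_val w \in X.
Proof.
split; first by move/(@eqquotP _ (same_line_equiv X))/asboolP.
by move=> H; apply/(@eqquotP _ (same_line_equiv X))/asboolP.
Qed.

Definition line_of X (v : V) (vX : v \notin X) : proj_quot X :=
  line (SigSub (mem_set (vX : off_subspace X v))).

Lemma line_ofP X (v w : V) (vX : v \notin X) (wX : w \notin X) :
  line_of vX = line_of wX <-> exists2 c : R, c != 0 & v - c *: w \in X.
Proof. by rewrite /line_of lineP. Qed.

Definition proj_space : Type := proj_quot 0%VS.
HB.instance Definition _ := Topological.on proj_space.

(* The linear subspace P(W) of P(V). *)
Definition proj_sub (W : {vspace V}) : set proj_space :=
  [set line v | v in [set v : off_subspace 0%VS | set_val v \in W]].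

End ProjectiveQuotient.

Section Wonderful.
Variables (R : realType) (n : nat).
Local Notation V := 'rV[R]_n.

Definition coord_hyperplane (i : 'I_n) : {vspace V} :=
  lker (linfun (fun v : V => v 0 i : R^o)).

Lemma mem_coord_hyperplane i (v : V) :
  (v \in coord_hyperplane i) = (v 0 i == 0).
Proof.
have lin : linear (fun v : V => v 0 i : R^o) by move=> a u w; rewrite !mxE.
pose f := GRing.isLinear.Build R V R^o *:%R (fun v : V => v 0 i : R^o) lin.
pose F : {linear V -> R^o} := HB.pack (fun v : V => v 0 i : R^o) f.
by rewrite memv_ker (lfunE F).
Qed.

Definition coord_intersection (I : {set 'I_n}) : {vspace V} :=
  (\bigcap_(i in I) coord_hyperplane i)%VS.

Lemma mem_coord_intersection (I : {set 'I_n}) (v : V) :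
  (v \in coord_intersection I) = [forall i in I, v 0 i == 0].
Proof.
rewrite /coord_intersection memvE; apply/subv_bigcapP/forall_inP => H i iI.
  by rewrite -mem_coord_hyperplane memvE H.
by rewrite -memvE mem_coord_hyperplane H.
Qed.

Definition coord_lattice : set {vspace V} :=
  [set coord_intersection I | I in [set I : {set 'I_n} | (0 < #|I| < n)%N]].

Definition arrangement_compl : set (proj_space R n) :=
  ~` \bigcup_(i : 'I_n) proj_sub (coord_hyperplane i).

Definition wonderful_factors : Type :=
  prod_topology (fun X : coord_lattice => proj_quot (set_val X)).

HB.instance Definition _ := Topological.on wonderful_factors.

Lemma arrangement_complP (p : arrangement_compl) (X : coord_lattice) :
  set_val (repr (set_val p)) \notin set_val X.
Proof.
have [I /= /andP[/card_gt0P[i iI] _] XI] := set_valP X.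
apply/negP; rewrite -[set_val X]XI mem_coord_intersection => /forall_inP/(_ i iI) vi.
apply: (set_valP p); exists i => //; exists (repr (set_val p)).
  by rewrite /= mem_coord_hyperplane.
by rewrite /line reprK.
Qed.

(* The map F: a point of P(V) off the arrangement, spanned by v, is sent to the
   family of the lines spanned by the images of v in the V/X.  It is defined
   through a representative v, on which it does not depend (wonderful_mapE). *)
Definition wonderful_map (p : arrangement_compl) : wonderful_factors :=
  fun X => line_of (arrangement_complP p X).

Lemma wonderful_mapE (p : arrangement_compl) (X : coord_lattice)
    (v : off_subspace 0%VS) (vX : set_val v \notin set_val X) :
  line v = set_val p -> wonderful_map p X = line_of vX.
Proof.
move=> vp; apply/line_ofP.
have : line (repr (set_val p)) = line v by rewrite vp /line reprK.
move/lineP => [c c0]; rewrite memv0 => /eqP cE.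
by exists c => //; rewrite cE mem0v.
Qed.

Definition wonderful_compactification : set (proj_space R n * wonderful_factors) :=
  closure (range (fun p => (set_val p, wonderful_map p))).

End Wonderful.

(* Main.v *)
Require Import Defs.
From HB Require Import structures.
From mathcomp Require Import all_boot all_order all_algebra.
From mathcomp Require Import all_classical all_reals all_analysis.
From mathcomp Require Import ring lra.

Set Implicit Arguments.
Unset Strict Implicit.
Unset Printing Implicit Defensive.

Import Order.TTheory GRing.Theory Num.Theory.
Import numFieldNormedType.Exports.

Local Open Scope classical_set_scope.
Local Open Scope ring_scope.

(** For D = diag d, the equation A^T D A = D says that d_i (A^-1)_ij = d_j A_ji
    for all i, j, so it involves D only through the points [d_i : d_j] of the
    projective line.  These ratios extend continuously from the complement of
    the coordinate hyperplanes (the torus below) to its compactification W: they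
    are the factors of index I = {i, j}.  Hence a point q of W with ratios
    [a_ij : a_ji] defines a set of matrices,
      limit_set q = { A | a_ij (A^-1)_ij = a_ji A_ji for all i, j },
    which is the group O(D) when q is a torus point.  The theorem holds because
    q |-> limit_set q is a continuous injection of the compact space W into the
    Hausdorff space of closed subgroups: it is then a homeomorphism onto its
    image, and the image is the closure of the groups O(D) because the torus is
    dense in W.

    Limit sets are groups.  The pairs (A, B) with a_ij B_ij = a_ji A_ji form a
    subalgebra of the product of the matrix algebra with its opposite
    (adjoint_pairM), thanks to the cocycle relation between the ratios.

    Continuity.  For the Chabauty topology it has two halves.  Limit sets that
    miss a compact set go on missing it (limit_upper), because the incidence
    relation A \in limit_set q is closed.  Limit sets that meet an open set go
    on meeting it (limit_lower): the Cayley transform turns the quadratic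
    equations of the limit set into the linear ones a_ij X_ij = - a_ji X_ji,
    whose solutions are easily moved along with the ratios.  The Cayley
    transform misses the matrices with eigenvalue -1, but each matrix has a
    product with a diagonal sign matrix, an element of every limit set, that
    avoids this eigenvalue (sign_shift_unit).

    Injectivity.  A reflection in the limit set of q that moves only the
    coordinates i and j determines [a_ij : a_ji] (planar_reflection), and on W
    the ratios determine all the factors (wonderful_eq). *)

(** * Adjoint pairs of matrices and the Cayley transform *)

Section AdjointPairs.
Variables (R : realType) (m : nat).
Local Notation n := m.+1.
Implicit Types (a A B X : 'M[R]_n).

(** Entries (i, j) and (j, i) of a are read as homogeneous coordinates of a point
    of the projective line.  When a i j : a j i = d_i : d_j, this is the relation
    D B = A^T D for D = diag d. *)
Definition adjoint_pair a A B := forall i j, a i j * B i j = a j i * A j i.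

(** The cocycle relation is (d_i / d_k) (d_k / d_j) (d_j / d_i) = 1 cleared of
    denominators. *)
Definition ratio_matrix a : Prop :=
  (forall i j, (a i j != 0) || (a j i != 0)) /\
  (forall i j k, a i k * a k j * a j i = a k i * a j k * a i j).

Lemma adjoint_pairC a A B : adjoint_pair a A B -> adjoint_pair a B A.
Proof. by move=> h i j; rewrite h. Qed.

Lemma adjoint_pair_scalar a c : adjoint_pair a c%:M c%:M.
Proof.
move=> i j; rewrite !mxE eq_sym.
by have [->|] := eqVneq j i => //=; rewrite !mulr0n !mulr0.
Qed.

Lemma adjoint_pair_diag a e : adjoint_pair a (diag_mx e) (diag_mx e).
Proof.
move=> i j; rewrite !mxE eq_sym.
by have [->|] := eqVneq j i => //=; rewrite !mulr0n !mulr0.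
Qed.

Lemma adjoint_pairD a A B A' B' : adjoint_pair a A B -> adjoint_pair a A' B' ->
  adjoint_pair a (A + A') (B + B').
Proof. by move=> h h' i j; rewrite !mxE !mulrDr h h'. Qed.

Lemma adjoint_pairN a A B : adjoint_pair a A B -> adjoint_pair a (- A) (- B).
Proof. by move=> h i j; rewrite !mxE !mulrN h. Qed.

(** The relation holds for each summand of the two matrix products.  By the
    cocycle relation, the ratio of indices i, j is the product of those of
    indices i, k and k, j, unless this product is 0 : 0. *)
Lemma adjoint_pairM a A B A' B' : ratio_matrix a ->
  adjoint_pair a A B -> adjoint_pair a A' B' ->
  adjoint_pair a (A *m A') (B' *m B).
Proof.
move=> [nz coc] h h' i j; rewrite !mxE !mulr_sumr; apply: eq_bigr => k _.
have /orP := nz i k; have /orP := nz k j.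
have := h k j; have := h' i k; have := coc i j k.
move: (a i k) (a k i) (a k j) (a j k) (a i j) (a j i) (B k j) (B' i k) (A j k) (A' k i).
move=> x x' y y' z z' b b' c c' E Eb' Eb hy hx.
have [xy0|xy0] := eqVneq (x * y) 0; last first.
  apply: (mulfI xy0).
  have -> : x * y * (z * (b' * b)) = z * (x * b') * (y * b) by ring.
  have -> : x * y * (z' * (c * c')) = (x * y * z') * (c * c') by ring.
  by rewrite Eb' Eb E; ring.
have [x'y'0|x'y'0] := eqVneq (x' * y') 0; last first.
  apply: (mulfI x'y'0).
  have -> : x' * y' * (z' * (c * c')) = z' * (x' * c') * (y' * c) by ring.
  have -> : x' * y' * (z * (b' * b)) = (x' * y' * z) * (b' * b) by ring.
  by rewrite -Eb' -Eb -E; ring.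
(* The product of the two ratios is 0 : 0, so one of them is 0 and the other is
   infinite; both sides then vanish. *)
move/eqP: xy0; rewrite mulf_eq0 => /orP[]/eqP h0;
  move: hx hy Eb' Eb x'y'0; rewrite h0 ?eqxx/=.
- case=> // x'0 hy; rewrite mul0r => /esym/eqP; rewrite mulf_eq0 (negPf x'0)/=.
  move=> /eqP-> Eb /eqP; rewrite mulf_eq0 (negPf x'0)/= => /eqP y'0.
  move: hy Eb; rewrite y'0 eqxx mul0r => -[]// y0 /eqP.
  by rewrite mulf_eq0 (negPf y0)/= => /eqP->; rewrite !mulr0.
- move=> hx [//|y'0]; rewrite mul0r => Eb' /esym/eqP.
  rewrite mulf_eq0 (negPf y'0)/= => /eqP-> /eqP.
  rewrite mulf_eq0 (negPf y'0) orbF => /eqP x'0.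
  move: hx Eb'; rewrite x'0 eqxx mul0r => -[]// x0 /eqP.
  by rewrite mulf_eq0 (negPf x0)/= => /eqP->; rewrite !(mulr0,mul0r).
Qed.

Lemma adjoint_pair_horner a A B (p : {poly R}) : ratio_matrix a ->
  adjoint_pair a A B -> adjoint_pair a (horner_mx A p) (horner_mx B p).
Proof.
move=> ra h; elim/poly_ind: p => [|p c IH].
  by rewrite !rmorph0 => i j; rewrite !mxE !mulr0.
rewrite !rmorphD !rmorphM /= !horner_mx_X !horner_mx_C.
apply: adjoint_pairD; last exact: adjoint_pair_scalar.
have -> : horner_mx B p * B = B *m horner_mx B p.
  by rewrite mulmxE; exact: (comm_horner_mx _ (erefl (B * B))).
exact: adjoint_pairM.
Qed.

(** By the theorem of Cayley and Hamilton, one polynomial gives the inverse of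
    both A and B. *)
Lemma adjoint_pair_inv a A B : ratio_matrix a -> A \in unitmx -> B \in unitmx ->
  adjoint_pair a A B -> adjoint_pair a (invmx A) (invmx B).
Proof.
move=> ra Au Bu h.
have [p [pA pB p0]] : exists p : {poly R},
    [/\ horner_mx A p = 0, horner_mx B p = 0 & p.[0] != 0].
  exists (char_poly A * char_poly B); split.
  - by rewrite rmorphM /= Cayley_Hamilton mul0r.
  - by rewrite rmorphM /= [X in _ * X]Cayley_Hamilton mulr0.
  - by rewrite hornerM !horner_coef0 !char_poly_det !mulf_neq0// ?signr_eq0//
      -unitfE -unitmxE.
have [g gE] : exists g, p - p.[0]%:P = g * 'X.
  have /factor_theorem[g gE] : root (p - p.[0]%:P) 0.
    by rewrite /root hornerD hornerN hornerC subrr.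
  by exists g; rewrite gE subr0.
have key (M : 'M[R]_n) : M \in unitmx -> horner_mx M p = 0 ->
    invmx M = horner_mx M (- p.[0]^-1 *: g).
  move=> Mu Mp; apply: (can_inj (mulmxK Mu)); rewrite mulVmx//.
  have := congr1 (horner_mx M) gE.
  rewrite rmorphB rmorphM /= Mp horner_mx_X horner_mx_C sub0r => gM.
  rewrite linearZ/= -scalemxAl mulmxE -gM.
  by rewrite scalerN scaleNr opprK scale_scalar_mx mulVf.
by rewrite (key A)// (key B)//; exact: adjoint_pair_horner.
Qed.

(** When B is the inverse of A, the Cayley transform of B is the opposite of the
    one of A, and both are obtained from the pair (A, B) by the operations that
    preserve adjoint pairs. *)
Lemma cayley_adjoint_pair a A B : ratio_matrix a ->
  adjoint_pair a A B -> A *m B = 1%:M -> 1%:M + A \in unitmx ->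
  let X := (1%:M - A) *m invmx (1%:M + A) in adjoint_pair a X (- X).
Proof.
move=> ra h AB Au X.
have BA := mulmx1C AB.
have [Aunit Bunit] := mulmx1_unit AB.
have Bu : 1%:M + B \in unitmx.
  have -> : 1%:M + B = B *m (1%:M + A) by rewrite mulmxDr mulmx1 BA addrC.
  by rewrite unitmx_mul Bunit.
have -> : - X = invmx (1%:M + B) *m (1%:M - B).
  apply: (can_inj (mulmxK Au)); apply: (can_inj (mulKmx Bu)).
  rewrite mulNmx /X mulmxKV// -mulmxA mulKVmx//.
  rewrite !(mulmxBr,mulmxDr,mulmxDl,mulmxBl,mulNmx,mulmxN,mulmx1,mul1mx) BA.
  by apply/matrixP => i j; rewrite !mxE; ring.
have h1 := adjoint_pair_scalar a 1.
apply: adjoint_pairM => //; first exact/adjoint_pairD/adjoint_pairN.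
by apply: adjoint_pair_inv => //; exact: adjoint_pairD.
Qed.

Lemma cayley_inv_adjoint_pair a X : ratio_matrix a ->
  adjoint_pair a X (- X) -> 1%:M + X \in unitmx -> 1%:M - X \in unitmx ->
  let A := (1%:M - X) *m invmx (1%:M + X) in
  (A \in unitmx) /\ adjoint_pair a A (invmx A).
Proof.
move=> ra h Xu X'u A.
have Au : A \in unitmx by rewrite unitmx_mul X'u unitmx_inv.
split=> //.
have -> : invmx A = invmx (1%:M - X) *m (1%:M + X).
  apply: (can_inj (mulKmx Au)); rewrite mulmxV// /A.
  have -> : (1%:M - X) *m invmx (1%:M + X) = invmx (1%:M + X) *m (1%:M - X).
    apply: (can_inj (mulmxK Xu)); apply: (can_inj (mulKmx Xu)).
    rewrite mulmxKV// -mulmxA mulKVmx//.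
    by rewrite !(mulmxBr,mulmxDr,mulmxDl,mulmxBl,mulNmx,mulmxN,mulmx1,mul1mx);
      apply/matrixP => i j; rewrite !mxE; ring.
  by rewrite mulmxA mulmxK// mulVmx.
have h1 := adjoint_pair_scalar a 1.
apply: adjoint_pairM => //.
  by apply: adjoint_pairD => //; rewrite -[X in adjoint_pair _ _ X]opprK;
    exact: adjoint_pairN.
by apply: adjoint_pair_inv => //; exact: adjoint_pairD.
Qed.

Lemma cayleyK A : A \in unitmx -> 1%:M + A \in unitmx ->
  let X := (1%:M - A) *m invmx (1%:M + A) in
  [/\ 1%:M + X \in unitmx, 1%:M - X \in unitmx &
      (1%:M - X) *m invmx (1%:M + X) = A].
Proof.
move=> Au Cu X.
have two : (2 : R) \is a GRing.unit by rewrite unitfE pnatr_eq0.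
have XE : 1%:M + X = 2 *: invmx (1%:M + A).
  apply: (can_inj (mulmxK Cu)); rewrite mulmxDl mul1mx mulmxKV// -scalemxAl.
  by rewrite mulVmx//; apply/matrixP => i j; rewrite !mxE; ring.
have X'E : 1%:M - X = 2 *: (A *m invmx (1%:M + A)).
  apply: (can_inj (mulmxK Cu)); rewrite mulmxBl mul1mx mulmxKV// -scalemxAl.
  by rewrite mulmxKV//; apply/matrixP => i j; rewrite !mxE; ring.
rewrite XE X'E; split.
- by rewrite unitmxZ// unitmx_inv.
- by rewrite unitmxZ// unitmx_mul Au unitmx_inv.
- rewrite invmxZ ?unitmx_inv//; last by rewrite unitmxZ// unitmx_inv.
  rewrite invmxK -scalemxAl -scalemxAr scalerA divrr// scale1r.
  by rewrite mulmxKV.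
Qed.

(** A is the reflection along e_i + s e_j, orthogonal for the form
    a_ij x_i^2 + a_ji x_j^2, which may be degenerate. *)
Lemma planar_reflection a i j : ratio_matrix a -> i != j ->
  exists A, [/\ A *m A = 1%:M, adjoint_pair a A A &
    (A i j != 0) || (A j i != 0)].
Proof.
move=> [nz _] ij; have ji : j != i by rewrite eq_sym.
(* The vector e_i + s e_j must not be isotropic; s = 1 or s = 2 will do. *)
have [s [s0 q0]] : exists s : R, s != 0 /\ a i j + a j i * s ^+ 2 != 0.
  have [q0|q0] := eqVneq (a i j + a j i) 0.
    exists 2; split; first by rewrite pnatr_eq0.
    apply/negP => /eqP q1; have := nz i j.
    have -> : a i j = 0 by lra.
    have -> : a j i = 0 by lra.
    by rewrite eqxx.
  by exists 1; rewrite oner_neq0 expr1n mulr1.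
set q := a i j + a j i * s ^+ 2 in q0 *.
pose v : 'cV[R]_n := \col_k ((k == i)%:R + s * (k == j)%:R).
pose w : 'rV[R]_n := \row_k (2 / q * (a i j * (k == i)%:R + s * a j i * (k == j)%:R)).
have wv : w *m v = 2%:M.
  apply/matrixP => k l; rewrite !ord1 !mxE (bigD1 i)//= (bigD1 j) 1?eq_sym//=.
  rewrite big1 => [|o /andP[/negPf oi /negPf oj]]; last first.
    by rewrite !mxE oi oj !mulr0 addr0 mulr0.
  rewrite !mxE !eqxx (negPf ij) (negPf ji) mulr1n /=.
  by rewrite /q; field.
pose A := 1%:M - v *m w.
have AE k l : A k l = (k == l)%:R - ((k == i)%:R + s * (k == j)%:R) *
   (2 / q * (a i j * (l == i)%:R + s * a j i * (l == j)%:R)).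
  by rewrite !mxE big_ord1 !mxE.
exists A; split.
- rewrite /A mulmxBl mul1mx mulmxBr mulmx1 mulmxA -[v *m w *m v]mulmxA wv.
  rewrite mul_mx_scalar -scalemxAl.
  by apply/matrixP => k l; rewrite !mxE; ring.
- move=> k l; rewrite !AE eq_sym.
  have [->|kl] := eqVneq l k; first by [].
  rewrite !sub0r !mulrN; congr (- _).
  have [ki|ki] := eqVneq k i; have [li|li] := eqVneq l i;
    have [kj|kj] := eqVneq k j; have [lj|lj] := eqVneq l j;
    rewrite /= ?mulr0 ?mulr1 ?addr0 ?mul0r ?mulr0 ?add0r ?mulr0 ?mul0r//;
    subst; rewrite ?eqxx// in ij kl *; ring.
- rewrite !AE !eqxx (negPf ij) (negPf ji) /=.
  rewrite !sub0r !oppr_eq0 !mulr0 !mulr1 !addr0 !add0r mul1r.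
  by rewrite !mulf_eq0 !invr_eq0 (negPf q0) (negPf s0) pnatr_eq0 /= orbC nz.
Qed.

End AdjointPairs.

Lemma invmx_mulmx (R : comUnitRingType) n (A B : 'M[R]_n) :
  A \in unitmx -> B \in unitmx -> invmx (A *m B) = invmx B *m invmx A.
Proof.
move=> Au Bu; have ABu : A *m B \in unitmx by rewrite unitmx_mul Au.
apply: (can_inj (mulKmx ABu)).
by rewrite mulmxV// mulmxA mulmxK// mulmxV.
Qed.

(** The determinant of A + diag e is affine in the first sign, and its slope is
    the same determinant for the lower right block of A.  By induction the other
    signs can be chosen with a slope different from 0, and then the values at 1
    and -1 are not both 0. *)
Lemma sign_shift_unit (R : realType) n (A : 'M[R]_n) :
  exists2 e : 'rV[R]_n, (forall i, e 0 i ^+ 2 = 1) & A + diag_mx e \in unitmx.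
Proof.
elim: n A => [|n IH] A.
  by exists 0 => [[]//|]; rewrite unitmxE det_mx00 unitr1.
have [e' e'1 e'u] := IH (drsubmx (A : 'M[R]_(1 + n))).
pose e (s : R) : 'rV[R]_(1 + n) := row_mx s%:M e'.
pose M s := (A : 'M[R]_(1 + n)) + diag_mx (e s).
have e0 s : e s 0 (lshift n (0 : 'I_1)) = s by rewrite row_mxEl mxE.
have eS s k : e s 0 (rshift 1 k) = e' 0 k by rewrite row_mxEr.
have Sk k : lift (0 : 'I_(1 + n)) k = rshift 1 k by exact: val_inj.
have E0 : 0 = lshift n 0 :> 'I_(1 + n) by exact: val_inj.
have ME s k l : M s k l = A k l + e s 0 k *+ (k == l).
  by rewrite /M mxE [diag_mx _ _ _]mxE.
have sq (s : R) : s ^+ 2 = 1 -> forall i, e s 0 i ^+ 2 = 1.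
  move=> s1 i; rewrite /e -(splitK i); case: (fintype.split i) => k /=.
    by rewrite row_mxEl !mxE [k]ord1 eqxx mulr1n.
  by rewrite row_mxEr.
have MD s : M s = A + diag_mx (e s) by [].
clearbody M; clearbody e.
have Mdet : \det (M 1) - \det (M (-1)) =
    2 * \det (drsubmx (A : 'M[R]_(1 + n)) + diag_mx e').
  have cof s k : cofactor (M s) 0 k = \det (row' 0 (col' k (M 1))) * (-1) ^+ k.
    rewrite /cofactor mulrC add0n; congr (\det _ * _); apply/matrixP => x y.
    by rewrite !mxE !ME Sk !eS.
  rewrite !(expand_det_row _ (0 : 'I_(1 + n))) -sumrB (bigD1 0)//= big1 => [|k k0].
    rewrite addr0 !cof -mulrBl !ME eqxx !mulr1n E0 !e0.
    rewrite expr0 mulr1.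
    congr (_ * _); first by ring.
    congr (\det _).
    by apply/matrixP => x y; rewrite !mxE ME -E0 !Sk eS (inj_eq (@rshift_inj _ _)).
  by rewrite !cof !ME eq_sym (negPf k0) !mulr0n subrr.
have [M1|M1] := boolP (M 1 \in unitmx).
  by exists (e 1); rewrite -?MD//; apply: sq; rewrite expr1n.
exists (e (-1)); first by apply: sq; rewrite sqrrN expr1n.
rewrite -MD unitmxE unitfE; apply/negP => /eqP d1.
move: M1 Mdet; rewrite unitmxE unitfE negbK => /eqP->.
rewrite [\det _ in LHS]d1 subrr => /esym/eqP; rewrite mulf_eq0 pnatr_eq0/=.
by apply/negP; rewrite -unitfE -unitmxE.
Qed.

(** * Subspaces, the Chabauty topology and matrices *)

Section Subtypes.
Variables (X : topologicalType) (A : set X).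

Lemma nbhs_set_val (x : A) (S : set X) :
  nbhs (set_val x) S -> nbhs x (set_val @^-1` S).
Proof. by move=> xS; exact: (@initial_continuous A X set_val x S). Qed.

Lemma compact_set_val (K : set X) : compact K -> K `<=` A ->
  compact (set_val @^-1` K : set A).
Proof.
move=> cK KA F PF FK.
have [x [Kx Fx]] := cK (set_val @ F) _ FK.
exists (SigSub (mem_set (KA _ Kx))); split=> // P N FP [_ [ [W oW <-] Wx WN]].
have [_ [ [y Py <-] Wy]] : set_val @` P `&` W !=set0.
  apply: Fx; last exact: open_nbhs_nbhs.
  by apply: (@filterS _ F _ _ _ _ FP) => y Py; exists y.
by exists y; split=> //; exact: WN.
Qed.

Lemma hausdorff_set_type : hausdorff_space X -> hausdorff_space A.
Proof.
move=> hX p q pq; apply: val_inj; apply: hX => P Q /nbhs_set_val Pp /nbhs_set_val Qq.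
by have [z [Pz Qz]] := pq _ _ Pp Qq; exists (set_val z).
Qed.

End Subtypes.

Lemma compact_inv_continuous (X Y : topologicalType) (f : X -> Y) (g : Y -> X) :
  compact [set: X] -> hausdorff_space Y -> continuous f ->
  cancel f g -> cancel g f -> continuous g.
Proof.
move=> cX hY cf fg gf; apply/continuous_closedP => C cC.
have -> : g @^-1` C = f @` C.
  by apply/seteqP; split=> [y Cy|_ [x Cx <-]/=]; [exists (g y)|rewrite fg].
apply: compact_closed => //; apply: continuous_compact.
  exact: continuous_subspaceT.
exact: subclosed_compact cC cX _.
Qed.

Section ChabautyTopology.
Variable G : groupTopType.

Lemma open_chabauty_subbase (O : set (closed_subgroup G)) :
  chabauty_subbase O -> open O.
Proof.
move=> bO; exists [set O]; last by rewrite bigcup_set1.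
by move=> _ ->; exact: (@finI_from1 _ _ _ id).
Qed.

Lemma open_miss (K : set G) : compact K ->
  open [set H : closed_subgroup G | carrier H `&` K = set0].
Proof. by move=> cK; apply: open_chabauty_subbase; left; exists K. Qed.

Lemma open_hit (U : set G) : open U ->
  open [set H : closed_subgroup G | carrier H `&` U !=set0].
Proof. by move=> oU; apply: open_chabauty_subbase; right; exists U. Qed.

(** The two conditions are upper and lower semicontinuity; each concerns one of
    the two kinds of subbasic open sets. *)
Lemma cvg_chabauty T (F : set_system T) (f : T -> closed_subgroup G) H :
  Filter F ->
  (forall K, compact K -> carrier H `&` K = set0 ->
     \forall t \near F, carrier (f t) `&` K = set0) ->
  (forall U, open U -> carrier H `&` U !=set0 ->
     \forall t \near F, carrier (f t) `&` U !=set0) ->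
  f @ F --> H.
Proof.
move=> FF hK hU S [B [ [D' sD <-] [B' D'B' HB'] BS]].
rewrite nbhs_simpl /=.
have [E sE EB'] := sD _ D'B'.
suff : \forall t \near F, B' (f t) by apply: filterS => t B't; apply: BS; exists B'.
move: HB'; rewrite -EB' => HE.
apply: (@filter_bigI _ (set (closed_subgroup G)) E (fun W => f @^-1` W)) => W WE.
have : chabauty_subbase W by apply/set_mem; exact: sE.
have : W H by exact: HE.
by move=> + [ [K cK WK]|[U oU WU]]; rewrite ?WK ?WU; [exact: hK|exact: hU].
Qed.

(** Two closed subgroups differ by an element of one of them outside the other;
    a compact neighbourhood of this element misses the latter. *)
Lemma chabauty_hausdorff :
  (forall (x : G) (U : set G), open U -> U x ->
     exists V K, [/\ open V, V x, V `<=` K, compact K & K `<=` U]) ->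
  hausdorff_space (closed_subgroup G).
Proof.
move=> lc.
have sep (H H' : closed_subgroup G) x : carrier H x -> ~ carrier H' x ->
    exists P Q, [/\ open P, open Q, P H, Q H' & P `&` Q = set0].
  move=> Hx H'x.
  have [cH' _ _ _] : is_closed_subgroup (carrier H') := set_valP H'.
  have [V [K [oV Vx VK cK KH']]] := lc x (~` carrier H') (closed_openC cH') H'x.
  exists [set L | carrier L `&` V !=set0], [set L | carrier L `&` K = set0].
  split; [exact: open_hit|exact: open_miss|by exists x| |].
    by rewrite /= -subset0 => y [H'y /KH'].
  rewrite -subset0 => L [ [y [Ly /VK Ky]] LK].
  by have : (carrier L `&` K) y by []; rewrite LK.
move=> H H' HH'; apply: val_inj; apply/seteqP.
split=> x Hx; apply: contrapT => H'x.
  have [P [Q [oP oQ PH QH' PQ]]] := sep _ _ _ Hx H'x.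
  have [L] := HH' _ _ (open_nbhs_nbhs (conj oP PH)) (open_nbhs_nbhs (conj oQ QH')).
  by rewrite PQ.
have [P [Q [oP oQ PH QH' PQ]]] := sep _ _ _ Hx H'x.
have [L] := HH' _ _ (open_nbhs_nbhs (conj oQ QH')) (open_nbhs_nbhs (conj oP PH)).
by rewrite setIC PQ.
Qed.

End ChabautyTopology.

Section MatrixTopology.
Variable R : realType.

Lemma cvg_mx T (F : set_system T) p q (f : T -> 'M[R]_(p, q))
    (A : 'M[R]_(p, q)) : Filter F ->
  (forall i j, f t i j @[t --> F] --> A i j) -> f @ F --> A.
Proof.
move=> FF h S [P PA PS]; rewrite nbhs_simpl /=.
have : \forall t \near F, forall ij : 'I_p * 'I_q, P ij.1 ij.2 (f t ij.1 ij.2).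
  by apply: filter_forall => -[i j]; exact: h (PA i j).
by apply: filterS => t ht; apply: PS => i j; exact: (ht (i, j)).
Qed.

Lemma cvg_entry T (F : set_system T) p q (f : T -> 'M[R]_(p, q))
    (A : 'M[R]_(p, q)) i j :
  Filter F -> f @ F --> A -> f t i j @[t --> F] --> A i j.
Proof. by move=> FF fA; exact: continuous_cvg (@coord_continuous _ _ _ i j A) fA. Qed.

Lemma cvg_mulmx T (F : set_system T) p q r (f : T -> 'M[R]_(p, q))
    (g : T -> 'M[R]_(q, r)) (A : 'M[R]_(p, q)) (B : 'M[R]_(q, r)) : Filter F ->
  f @ F --> A -> g @ F --> B -> (f t *m g t) @[t --> F] --> A *m B.
Proof.
move=> FF fA gB; apply: cvg_mx => i j; rewrite mxE.
under eq_cvg do rewrite mxE.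
apply: cvg_big => [|k _]; first exact: add_continuous.
by apply: cvgM; exact: cvg_entry.
Qed.

Lemma cvg_det T (F : set_system T) n (f : T -> 'M[R]_n) (A : 'M[R]_n) : Filter F ->
  f @ F --> A -> \det (f t) @[t --> F] --> \det A.
Proof.
move=> FF fA; apply: cvg_big => [|s _]; first exact: add_continuous.
apply: cvgM; first exact: cvg_cst.
apply: cvg_big => [|i _]; first exact: mul_continuous.
exact: cvg_entry.
Qed.

Lemma near_unitmx T (F : set_system T) n (f : T -> 'M[R]_n) (A : 'M[R]_n) : Filter F ->
  f @ F --> A -> A \in unitmx -> \forall t \near F, f t \in unitmx.
Proof.
move=> FF fA; rewrite unitmxE unitfE => A0.
have /(_ _ (open_nbhs_nbhs _))-/(_ [set x | x != 0]) := cvg_det FF fA.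
rewrite nbhs_simpl/=.
have o : open_nbhs (\det A) [set x : R | x != 0] by split=> //; exact: open_neq.
by move=> /(_ o); apply: filterS => t; rewrite /= unitmxE unitfE.
Qed.

Lemma cvg_invmx T (F : set_system T) n (f : T -> 'M[R]_n) (A : 'M[R]_n) : Filter F ->
  f @ F --> A -> A \in unitmx -> invmx (f t) @[t --> F] --> invmx A.
Proof.
move=> FF fA Au.
have : ((\det (f t))^-1 *: \adj (f t)) @[t --> F] --> invmx A.
  rewrite /invmx Au; apply: cvg_mx => i j; rewrite mxE.
  under eq_cvg do rewrite mxE.
  apply: cvgM.
    by apply: cvgV; [rewrite -unitfE -unitmxE|exact: cvg_det].
  rewrite mxE; under eq_cvg do rewrite mxE.
  apply: cvgM; first exact: cvg_cst.
  apply: cvg_det; apply: cvg_mx => k l; rewrite !mxE.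
  under eq_cvg do rewrite !mxE.
  exact: cvg_entry.
apply: cvg_trans; apply: near_eq_cvg.
by apply: filterS (near_unitmx FF fA Au) => t tu; rewrite /invmx tu.
Qed.

Lemma compact_mx_box p q (A : 'M[R]_(p, q)) (e : R) :
  compact [set M : 'M[R]_(p, q) | forall i j, A i j - e <= M i j <= A i j + e].
Proof.
pose v := mxvec A.
have cB : compact [set w : 'rV[R]_(p * q) | forall k,
    [set` `[v 0 k - e, v 0 k + e]] (w 0 k)].
  apply: (@rV_compact _ _ (fun k => `[v 0 k - e, v 0 k + e]%classic)) => k.
  exact: segment_compact.
have : compact (@vec_mx R p q @` [set w : 'rV[R]_(p * q) | forall k,
    [set` `[v 0 k - e, v 0 k + e]] (w 0 k)]).
  apply: continuous_compact => //; apply: continuous_subspaceT => w.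
  apply: (@cvg_mx _ (nbhs w)) => i j; rewrite mxE; under eq_cvg do rewrite mxE.
  exact: coord_continuous.
congr (compact _); apply/seteqP; split=> [_ [w hw <-] i j|M hM].
  by have := hw (mxvec_index i j); rewrite /= in_itv /= /v mxvecE mxE.
exists (mxvec M); last exact: mxvecK.
by move=> k; case/mxvec_indexP: k => i j; rewrite /= in_itv/= /v !mxvecE.
Qed.

(** The general linear group is open in the space of matrices, so small closed
    boxes around an invertible matrix are compact sets of invertible matrices. *)
Lemma GLn_locally_compact n (x : GLn R n) (U : set (GLn R n)) : open U -> U x ->
  exists V K, [/\ open V, V x, V `<=` K, compact K & K `<=` U].
Proof.
move=> [W oW <-] Ox.
have xO : nbhs (set_val x) (W `&` [set A : 'M[R]_n | A \in unitmx]).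
  apply: filterI; first exact: open_nbhs_nbhs.
  by apply: (@near_unitmx _ (nbhs (set_val x)) _ id); [exact: cvg_id|exact: GLn_unit].
have [e /= e0 eO] := (nbhs_ballP _ _).1 xO.
pose K0 := [set M : 'M[R]_n |
  forall i j, set_val x i j - e / 2 <= M i j <= set_val x i j + e / 2].
have K0O : K0 `<=` W `&` [set A : 'M[R]_n | A \in unitmx].
  move=> M KM; apply: eO; split=> // i j; rewrite /ball /=.
  have := KM i j; rewrite ltr_norml; lra.
exists (set_val @^-1` (ball (set_val x) (e / 2))°), (set_val @^-1` K0); split.
- by exists (ball (set_val x) (e / 2))° => //; exact: open_interior.
- by apply: nbhsx_ballx; rewrite divr_gt0.
- move=> A /nbhs_singleton [_ xA] i j.
  have := xA i j; rewrite /ball /= ltr_norml; lra.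
- by apply: compact_set_val => [|M /K0O []//]; exact: compact_mx_box.
- by move=> A /K0O [].
Qed.

End MatrixTopology.

(** * Coordinate ratios on a projective quotient *)

Section Ratios.
Variables (R : realType) (n : nat).
Local Notation V := 'rV[R]_n.
Implicit Types (X : {vspace V}) (I : {set 'I_n}) (u v : V).

(** A common treatment of the spaces V/X_I of the lattice and of V = V/0, for
    which I is the full set of indices. *)
Definition cuts_out X I := forall v, (v \in X) = [forall i in I, v 0 i == 0].

(** The entries of the orthogonal projector onto the line of (v_k)_(k in I).  They
    depend only on the class of v in P(V/X_I), and determine this class. *)
Definition coord_ratio I v i j := v 0 i * v 0 j / \sum_(k in I) v 0 k ^+ 2.

Lemma sumsq_neq0 I v k : k \in I -> v 0 k != 0 ->
  \sum_(i in I) v 0 i ^+ 2 != 0.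
Proof.
move=> kI vk; rewrite psumr_neq0 => [|i _]; last exact: sqr_ge0.
by apply/hasP; exists k; rewrite ?mem_index_enum// kI/= exprn_even_gt0.
Qed.

Lemma coord_ratio_scale I u v c i j :
  c != 0 -> (forall k, k \in I -> u 0 k = c * v 0 k) ->
  i \in I -> j \in I -> coord_ratio I u i j = coord_ratio I v i j.
Proof.
move=> c0 uv iI jI; rewrite /coord_ratio !uv//.
under eq_bigr => k kI do rewrite uv// exprMn.
rewrite -mulr_sumr invfM.
by rewrite mulrACA [X in X * _]mulrC mulrA mulrA; congr (_ * _); field.
Qed.

Lemma off_cuts_out X I v : cuts_out X I -> v \notin X ->
  exists2 k, k \in I & v 0 k != 0.
Proof.
by move=> -> ; rewrite negb_forall_in => /exists_inP[k kI vk]; exists k.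
Qed.

Definition repr_vector X (p : proj_quot X) : V := set_val (repr p).

Lemma repr_vector_off X (p : proj_quot X) : repr_vector p \notin X.
Proof. exact: (set_valP (repr p)). Qed.

Lemma repr_vector_line X (v : off_subspace X) :
  exists2 c : R, c != 0 & repr_vector (line v) - c *: set_val v \in X.
Proof. by apply/lineP; rewrite /line reprK. Qed.

Lemma eq_repr_vector X (p q : proj_quot X) c :
  c != 0 -> repr_vector p - c *: repr_vector q \in X -> p = q.
Proof.
move=> c0 pq; rewrite -[p]reprK -[q]reprK; apply/lineP.
by exists c.
Qed.

Lemma cuts_out_scale X I u v c : cuts_out X I -> u - c *: v \in X ->
  forall k, k \in I -> u 0 k = c * v 0 k.
Proof.
move=> -> /forall_inP h k kI; apply/eqP.
by have := h k kI; rewrite !mxE subr_eq0.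
Qed.

Lemma coord_ratio_continuous X I i j : cuts_out X I -> i \in I -> j \in I ->
  continuous (fun p : proj_quot X => coord_ratio I (repr_vector p) i j).
Proof.
move=> XI iI jI.
pose g (v : off_subspace X) := coord_ratio I (set_val v) i j.
apply: (@repr_comp_continuous _ _ _ g) => [v|v w].
  have cv k : (set_val w : V) 0 k @[w --> v] --> (set_val v : V) 0 k.
    apply: (@cvg_entry R _ (nbhs v) _ _ (fun w : off_subspace X => set_val w : V)).
    exact: (@initial_continuous (off_subspace X) V set_val v).
  apply: (cvgM (cvgM (cv i) (cv j))).
  apply: cvgV.
    have [k kI vk] := off_cuts_out XI (set_valP v).
    exact: sumsq_neq0 vk.
  apply: cvg_big => [|k _]; first exact: add_continuous.
  by rewrite expr2; under eq_cvg do rewrite expr2; exact: cvgM.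
move=> /eqP/lineP[c c0 vw]; apply/eqP.
exact: coord_ratio_scale c0 (cuts_out_scale XI vw) iI jI.
Qed.

(** Every class modulo X has a representative supported in I of norm 1. *)
Lemma proj_quot_compact X I : cuts_out X I -> compact [set: proj_quot X].
Proof.
move=> XI.
pose K0 := [set v : V | `|v| = 1 /\ forall k, k \notin I -> v 0 k = 0].
have cK0 : compact K0.
  apply: bounded_closed_compact.
    by exists 1; split; [exact: real1|move=> M M1 v [v1 _]; rewrite /= v1; exact: ltW].
  have -> : K0 = (fun v : V => `|v|) @^-1` [set 1] `&`
      \bigcap_(k in [set k : 'I_n | k \notin I]) (fun v : V => v 0 k) @^-1` [set 0].
    by apply/seteqP; split=> v [v1 v2]; split.
  apply: closedI.
    apply: closed_comp => [v _|]; first exact: norm_continuous.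
    exact: closed_eq.
  apply: closed_bigI => k _; apply: closed_comp => [v _|]; last exact: closed_eq.
  exact: coord_continuous.
have K0X : K0 `<=` off_subspace X.
  move=> v [v1 vI]; rewrite /off_subspace /= XI; apply/negP => /forall_inP h.
  have v0 : v = 0.
    apply/rowP => k; rewrite mxE; have [/h/eqP//|] := boolP (k \in I).
    exact: vI.
  by move: v1; rewrite v0 normr0 => /eqP; rewrite eq_sym oner_eq0.
have -> : [set: proj_quot X] = @line R n X @` (set_val @^-1` K0).
  apply/seteqP; split=> // p _.
  have [k kI pk] := off_cuts_out XI (repr_vector_off p).
  pose u : V := \row_i if i \in I then repr_vector p 0 i else 0.
  have u0 : `|u| != 0.
    rewrite normr_eq0; apply/eqP => /rowP/(_ k); rewrite !mxE kI => /eqP.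
    exact/negP.
  have uK : K0 (`|u|^-1 *: u).
    split; first by rewrite normrZ normfV normr_id mulVf.
    by move=> i iI; rewrite !mxE (negPf iI) mulr0.
  exists (SigSub (mem_set (K0X _ uK))) => //.
  rewrite -[p]reprK; apply/esym/lineP; exists `|u| => //=.
  rewrite scalerA divff// scale1r XI; apply/forall_inP => i iI.
  by rewrite !mxE iI subrr.
apply: continuous_compact; last exact: compact_set_val.
by apply: continuous_subspaceT; exact: pi_continuous.
Qed.

End Ratios.

(** * The factors of a point of the ambient product *)

Lemma closed_eq_fun (R : realType) (T : topologicalType) (f g : T -> R) :
  continuous f -> continuous g -> closed [set x | f x = g x].
Proof.
move=> cf cg.
have -> : [set x | f x = g x] = (fun x => f x - g x) @^-1` [set 0].
  by apply/seteqP; split=> x /= => [->|/eqP]; rewrite ?subrr// subr_eq0 => /eqP.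
apply: closed_comp => [x _|]; last exact: closed_eq.
by apply: cvgB; [exact: cf|exact: cg].
Qed.

Section Components.
Variables (R : realType) (n : nat).
Local Notation V := 'rV[R]_n.
Local Notation T := (proj_space R n * wonderful_factors R n)%type.
Implicit Types (I : {set 'I_n}) (q : T).

Lemma cuts_out_intersection I : cuts_out (@coord_intersection R n I) I.
Proof. by move=> v; rewrite mem_coord_intersection. Qed.

Lemma cuts_out0 : cuts_out (0%VS : {vspace V}) (finset.setT : {set 'I_n}).
Proof.
move=> v; rewrite memv0; apply/eqP/forall_inP => [-> i _|h]; first by rewrite mxE.
by apply/rowP => i; rewrite mxE; apply/eqP/h; rewrite inE.
Qed.

(** The full set of indices is excluded: for k outside a proper subset J, the
    basis vector e_k lies in X_J but not in X_I for I full. *)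
Lemma coord_latticeE I : I != finset.set0 ->
  coord_lattice (coord_intersection R I) <-> I <> (finset.setT : {set 'I_n}).
Proof.
move=> I0; split=> [[J /= /andP[_ Jn] JI] IT|IT].
  have [k kJ] : exists k, k \notin J.
    apply/existsP; rewrite -negb_forall; apply/negP => /forallP h.
    have JT : J = (finset.setT : {set 'I_n}) by apply/setP => k; rewrite !inE h.
    by move: Jn; rewrite JT cardsT card_ord ltnn.
  have : (delta_mx 0 k : V) \in coord_intersection R J.
    rewrite mem_coord_intersection; apply/forall_inP => i iJ; rewrite mxE eqxx /=.
    by have [ik|//] := eqVneq i k; rewrite -ik iJ in kJ.
  rewrite JI mem_coord_intersection => /forall_inP/(_ k).
  by rewrite IT inE mxE !eqxx oner_eq0 => /(_ isT).
exists I => //=; rewrite card_gt0 I0 /= -[X in (_ < X)%N]card_ord -cardsT.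
by apply: proper_card; rewrite properT; apply/eqP.
Qed.

(** A vector of homogeneous coordinates (v_i)_(i in I) for the factor of index I.
    For I full, where X_I = 0 is not in the lattice, the factor is P(V). *)
Definition factor_vector q I : V :=
  match pselect (coord_lattice (coord_intersection R I)) with
  | left h => repr_vector (q.2 (SigSub (mem_set h)))
  | right _ => repr_vector q.1
  end.

(** This hides the distinction between the factors P(V/X_I) and P(V). *)
Lemma factor_vectorE I : I != finset.set0 -> exists X (c : T -> proj_quot X),
  [/\ cuts_out X I, continuous c & forall q, factor_vector q I = repr_vector (c q)].
Proof.
move=> I0; rewrite /factor_vector; case: pselect => h.
  pose X : @coord_lattice R n := SigSub (mem_set h).
  exists (coord_intersection R I), (fun q => q.2 X); split=> //.
    exact: cuts_out_intersection.
  move=> q; apply: (@cvg_comp _ _ _ snd (fun f : wonderful_factors R n => f X)).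
    exact: cvg_snd.
  exact: (@proj_continuous _ _ X q.2).
have -> : I = (finset.setT : {set 'I_n}).
  by apply: contrapT => IT; apply: h; exact/coord_latticeE.
exists 0%VS, fst; split=> //; first exact: cuts_out0.
by move=> q; exact: cvg_fst.
Qed.

Lemma factor_vectorT q : (finset.setT : {set 'I_n}) != finset.set0 /\
  factor_vector q finset.setT = repr_vector q.1.
Proof.
have T0 : (finset.setT : {set 'I_n}) != finset.set0.
  have [k kT _] := off_cuts_out cuts_out0 (repr_vector_off q.1).
  by apply/set0Pn; exists k.
split=> //; rewrite /factor_vector; case: pselect => [h|//].
by case: ((coord_latticeE T0).1 h erefl).
Qed.

Lemma factor_vector_lattice (X : @coord_lattice R n) : exists I,
  [/\ I != finset.set0, cuts_out (set_val X) I &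
      forall q, factor_vector q I = repr_vector (q.2 X)].
Proof.
have [I /= /andP[I0 In] IX] := set_valP X.
exists I; split; first by rewrite -card_gt0.
  by rewrite -[set_val X]IX; exact: cuts_out_intersection.
move=> q; rewrite /factor_vector; case: pselect => [h|[]]; last first.
  by exists I => //=; rewrite I0.
have -> // : X = SigSub (mem_set h) by apply: val_inj.
Qed.

Lemma factor_vector_neq0 q I : I != finset.set0 ->
  exists2 k, k \in I & factor_vector q I 0 k != 0.
Proof.
move=> /factor_vectorE[X [c [XI _ ->]]].
exact: off_cuts_out (repr_vector_off (c q)).
Qed.

Lemma factor_ratio_continuous I i j : i \in I -> j \in I ->
  continuous (fun q : T => coord_ratio I (factor_vector q I) i j).
Proof.
move=> iI jI; have I0 : I != finset.set0 by apply/set0Pn; exists i.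
have [X [c [XI cc E]]] := factor_vectorE I0.
have -> : (fun q => coord_ratio I (factor_vector q I) i j) =
    (fun p => coord_ratio I (repr_vector p) i j) \o c by apply/funext => q; rewrite /= E.
by move=> q; apply: continuous_comp; [exact: cc|exact: coord_ratio_continuous].
Qed.

Definition torus_point (p : @arrangement_compl R n) : T :=
  (set_val p, wonderful_map p).

Lemma factor_vector_torus p (v : off_subspace (0%VS : {vspace V})) I :
  line v = set_val p -> I != finset.set0 ->
  exists2 c : R, c != 0 & forall k, k \in I ->
    factor_vector (torus_point p) I 0 k = c * set_val v 0 k.
Proof.
move=> vp I0; rewrite /factor_vector; case: pselect => h /=.
  set X : @coord_lattice R n := SigSub (mem_set h).
  have vX : set_val v \notin set_val X.
    apply/negP; rewrite mem_coord_intersection => /forall_inP v0.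
    have [i iI] := set0Pn _ I0.
    apply: (set_valP p); exists i => //; exists v => //.
    by rewrite /= mem_coord_hyperplane v0.
  rewrite (wonderful_mapE vX vp).
  have [c c0 cv] := repr_vector_line
    (SigSub (mem_set (vX : off_subspace (set_val X) (set_val v)))).
  by exists c => //; exact: cuts_out_scale (cuts_out_intersection I) cv.
rewrite -vp; have [c c0] := repr_vector_line v.
rewrite memv0 subr_eq0 => /eqP E; exists c => // k _.
by rewrite E mxE.
Qed.

Lemma torus_vector (p : @arrangement_compl R n) :
    exists v : off_subspace (0%VS : {vspace V}), line v = set_val p.
Proof. by exists (repr (set_val p)); rewrite /line reprK. Qed.

Local Notation W := (@wonderful_compactification R n).

(** A closed relation between the factors holds on the compactification as soon
    as it holds at the torus points, whose factors all come from one vector. *)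
Lemma wonderful_closed (P : set T) : closed P ->
  (forall p, P (torus_point p)) -> W `<=` P.
Proof.
move=> cP hP; rewrite (closure_id P).1//; apply: closure_subset.
by move=> _ [p _ <-]; exact: hP.
Qed.

(** The ratios [d_i : d_j] of a point, in the form expected by adjoint_pair. *)
Definition pair_mx q : 'M[R]_n := \matrix_(i, j) factor_vector q [set i; j] 0 i.

Lemma pair_mxE q i j : pair_mx q i j = factor_vector q [set i; j] 0 i.
Proof. by rewrite mxE. Qed.

Lemma pair_mxET q i j : pair_mx q j i = factor_vector q [set i; j] 0 j.
Proof. by rewrite mxE finset.setUC. Qed.

Lemma coord_ratio_factor I (u : V) l : l \in I -> u 0 l != 0 ->
  exists2 c, c != 0 & forall i, coord_ratio I u i l = u 0 i * c.
Proof.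
move=> lI ul; exists (u 0 l / \sum_(k in I) u 0 k ^+ 2).
  by rewrite mulf_neq0// invr_eq0; exact: sumsq_neq0 ul.
by move=> i; rewrite /coord_ratio mulrA.
Qed.

End Components.

(** * Relations between the factors on the wonderful compactification *)

(** Equality of points of the projective line is transitive. *)
Lemma proportional_trans (R : realType) (x y a b x' y' : R) :
  (a != 0) || (b != 0) -> x * b = y * a -> a * y' = b * x' -> x * y' = y * x'.
Proof.
move=> /orP[a0|b0] E E'.
  by apply: (mulfI a0); rewrite mulrCA E' mulrA E; ring.
by apply: (mulfI b0); rewrite mulrA [b * x]mulrC E -mulrA E'; ring.
Qed.

Section WonderfulRelations.
Variables (R : realType) (n : nat).
Local Notation V := 'rV[R]_n.
Local Notation T := (proj_space R n * wonderful_factors R n)%type.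
Local Notation W := (@wonderful_compactification R n).
Implicit Types (I : {set 'I_n}) (q : T).

Local Notation rr I q i j := (coord_ratio I (factor_vector q I) i j).

Lemma torus_ratio (p : @arrangement_compl R n) : exists v : V,
  forall I i j, i \in I -> j \in I -> rr I (torus_point p) i j = coord_ratio I v i j.
Proof.
have [v vp] := torus_vector p; exists (set_val v) => I i j iI jI.
have I0 : I != finset.set0 by apply/set0Pn; exists i.
have [c c0 E] := factor_vector_torus vp I0.
exact: coord_ratio_scale c0 E iI jI.
Qed.

(** The ratio of two coordinates of the factor I agrees with the factor {i, j}
    where it is defined.  The relation is closed because, expressed with
    coord_ratio, it involves only continuous functions of q. *)
Lemma wonderful_compat q I i j : W q -> i \in I -> j \in I ->
  factor_vector q I 0 i * pair_mx q j i = factor_vector q I 0 j * pair_mx q i j.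
Proof.
move=> Wq iI jI; rewrite pair_mxET pair_mxE.
set J := [set i; j]%SET.
have [iJ jJ] : i \in J /\ j \in J by rewrite !inE !eqxx orbT.
have I0 : I != finset.set0 by apply/set0Pn; exists i.
have J0 : J != finset.set0 by apply/set0Pn; exists i.
have [l lI ul] := factor_vector_neq0 q I0; have [s sJ ws] := factor_vector_neq0 q J0.
have [c c0 uE] := coord_ratio_factor lI ul; have [d d0 wE] := coord_ratio_factor sJ ws.
suff : rr I q i l * rr J q j s = rr I q j l * rr J q i s.
  rewrite !uE !wE => E; apply: (mulIf (mulf_neq0 c0 d0)).
  by rewrite mulrACA E mulrACA.
move: q Wq {ul ws uE wE}; apply: wonderful_closed.
  apply: closed_eq_fun => q; apply: cvgM; exact: factor_ratio_continuous.
move=> p /=; have [v E] := torus_ratio p.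
by rewrite !E// /coord_ratio; ring.
Qed.

(** At a torus point both sides are multiples of d_i d_k d_j by the same factor;
    the closedness argument is the one of wonderful_compat. *)
Lemma wonderful_cocycle q i j k : W q ->
  pair_mx q i k * pair_mx q k j * pair_mx q j i =
  pair_mx q k i * pair_mx q j k * pair_mx q i j.
Proof.
move=> Wq; rewrite (pair_mxET q i k) (pair_mxE q i k) (pair_mxET q k j).
rewrite (pair_mxE q k j) (pair_mxET q i j) (pair_mxE q i j).
set J := [set i; k]%SET; set K := [set k; j]%SET; set L := [set i; j]%SET.
have [iJ kJ] : i \in J /\ k \in J by rewrite !inE !eqxx orbT.
have [kK jK] : k \in K /\ j \in K by rewrite !inE !eqxx orbT.
have [iL jL] : i \in L /\ j \in L by rewrite !inE !eqxx orbT.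
have J0 : J != finset.set0 by apply/set0Pn; exists i.
have K0 : K != finset.set0 by apply/set0Pn; exists j.
have L0 : L != finset.set0 by apply/set0Pn; exists j.
have [l lJ ul] := factor_vector_neq0 q J0; have [r rK wr] := factor_vector_neq0 q K0.
have [s sL zs] := factor_vector_neq0 q L0.
have [c c0 uE] := coord_ratio_factor lJ ul; have [d d0 wE] := coord_ratio_factor rK wr.
have [e e0 zE] := coord_ratio_factor sL zs.
suff : rr J q i l * rr K q k r * rr L q j s = rr J q k l * rr K q j r * rr L q i s.
  rewrite !uE !wE !zE => E; apply: (mulIf (mulf_neq0 (mulf_neq0 c0 d0) e0)).
  by move: E; rewrite !(mulrACA _ c) !(mulrACA _ (c * d)).
move: q Wq {ul wr zs uE wE zE}; apply: wonderful_closed.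
  apply: closed_eq_fun => q; (apply: cvgM; first apply: cvgM);
    exact: factor_ratio_continuous.
move=> p /=; have [v E] := torus_ratio p.
by rewrite !E// /coord_ratio; ring.
Qed.

Lemma pair_mx_neq0 q i j : (pair_mx q i j != 0) || (pair_mx q j i != 0).
Proof.
have J0 : [set i; j]%SET != finset.set0 by apply/set0Pn; exists i; rewrite !inE eqxx.
have [k + uk] := factor_vector_neq0 q J0; rewrite !inE (pair_mxE q i j) (pair_mxET q i j).
by move=> /orP[]/eqP kE; move: uk; rewrite kE => ->; rewrite ?orbT.
Qed.

(** By wonderful_compat, the coordinates of the factors of index I of q and q' have
    the same ratios, so these factors are equal. *)
Lemma wonderful_eq q q' : W q -> W q' ->
  (forall i j, pair_mx q i j * pair_mx q' j i = pair_mx q j i * pair_mx q' i j) ->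
  q = q'.
Proof.
move=> Wq Wq' qq'.
have key I : I != finset.set0 -> exists2 c, c != 0 &
    forall k, k \in I -> factor_vector q I 0 k = c * factor_vector q' I 0 k.
  move=> I0; have [l lI wl] := factor_vector_neq0 q' I0.
  have [k kI vk] := factor_vector_neq0 q I0.
  have par i j : i \in I -> j \in I ->
      factor_vector q I 0 i * factor_vector q' I 0 j =
      factor_vector q I 0 j * factor_vector q' I 0 i.
    move=> iI jI; apply: proportional_trans (pair_mx_neq0 q i j) _ _.
      exact: wonderful_compat.
    apply: proportional_trans (pair_mx_neq0 q' i j) (qq' i j) _.
    by rewrite mulrC -(wonderful_compat Wq' iI jI) mulrC.
  have wk : factor_vector q' I 0 k != 0.
    apply/negP => /eqP w0; have := par _ _ kI lI; rewrite w0 mulr0 => /eqP.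
    by rewrite mulf_eq0 (negPf vk) (negPf wl).
  exists (factor_vector q I 0 k / factor_vector q' I 0 k).
    by rewrite mulf_neq0// invr_eq0.
  by move=> i iI; rewrite mulrAC par// mulfK.
have comp0 : q.1 = q'.1.
  have [T0 E] := factor_vectorT q; have [_ E'] := factor_vectorT q'.
  have [c c0 cE] := key _ T0.
  apply: (eq_repr_vector c0); rewrite -E -E' memv0 subr_eq0; apply/eqP/rowP => k.
  by rewrite mxE cE ?inE.
have comp1 X : q.2 X = q'.2 X.
  have [I [I0 XI E]] := factor_vector_lattice X; have [c c0 cE] := key _ I0.
  apply: (eq_repr_vector c0); rewrite -!E XI; apply/forall_inP => k kI.
  by rewrite !mxE cE// subrr.
move: q q' comp0 comp1 {Wq Wq' qq' key} => [q1 q2] [q1' q2'] /= -> E.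
by congr pair; apply: functional_extensionality_dep.
Qed.

End WonderfulRelations.

(** * The limit groups *)

Section LimitGroups.
Variables (R : realType) (m : nat).
Local Notation n := m.+1.
Local Notation V := 'rV[R]_n.
Local Notation T := (proj_space R n * wonderful_factors R n)%type.
Local Notation W := (@wonderful_compactification R n).
Local Notation GL := (GLn R n).
Implicit Types (I : {set 'I_n}) (q : T).

Local Notation rr q i j k l :=
  (coord_ratio [set i; j]%SET (factor_vector q [set i; j]%SET) k l).

Lemma pair_mx_ratio_matrix q : W q -> ratio_matrix (pair_mx q).
Proof.
by move=> Wq; split=> [i j|i j k]; [exact: pair_mx_neq0|exact: wonderful_cocycle].
Qed.

Definition limit_set q : set GL :=
  [set A | adjoint_pair (pair_mx q) (set_val A) (invmx (set_val A))].

(** The defining equations of limit_set, rewritten with functions that are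
    continuous in q. *)
Lemma ratio_pairP q i j (x y : R) :
  pair_mx q i j * x = pair_mx q j i * y <->
  forall l, l \in [set i; j]%SET -> rr q i j i l * x = rr q i j j l * y.
Proof.
rewrite (pair_mxE q i j) (pair_mxET q i j).
set J := [set i; j]%SET; split=> [E l lJ|E].
  rewrite /coord_ratio; set S := \sum_(k in J) _.
  transitivity (factor_vector q J 0 i * x * (factor_vector q J 0 l / S)); first by ring.
  by rewrite E; ring.
have J0 : J != finset.set0 by apply/set0Pn; exists i; rewrite !inE eqxx.
have [l lJ ul] := factor_vector_neq0 q J0; have [c c0 uE] := coord_ratio_factor lJ ul.
have := E l lJ; rewrite !uE => H; apply: (mulIf c0).
by rewrite mulrAC H mulrAC.
Qed.

Lemma cvg_GLn (A : GL) : (set_val B : 'M[R]_n) @[B --> A] --> (set_val A : 'M[R]_n).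
Proof. exact: (@initial_continuous GL 'M[R]_n set_val A). Qed.

Lemma closed_incidence : closed [set qA : T * GL | limit_set qA.1 qA.2].
Proof.
have -> : [set qA : T * GL | limit_set qA.1 qA.2] =
   \bigcap_(t in [set t : 'I_n * 'I_n * 'I_n | t.2 \in [set t.1.1; t.1.2]%SET])
     [set qA : T * GL |
        rr qA.1 t.1.1 t.1.2 t.1.1 t.2 * invmx (set_val qA.2) t.1.1 t.1.2 =
        rr qA.1 t.1.1 t.1.2 t.1.2 t.2 * set_val qA.2 t.1.2 t.1.1].
  apply/seteqP; split=> qA h.
    by move=> [[i j] l] /= lJ; exact: (ratio_pairP _ _ _ _ _).1 (h i j) l lJ.
  by move=> i j; apply/ratio_pairP => l lJ; exact: (h (i, j, l)).
apply: closed_bigI => -[[i j] l] /= lJ.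
have cq k : k \in [set i; j]%SET -> continuous (fun qA : T * GL => rr qA.1 i j k l).
  move=> kJ qA; apply: (@cvg_comp _ _ _ fst (fun q => rr q i j k l)).
    exact: cvg_fst.
  exact: factor_ratio_continuous.
have cA : forall qA : T * GL,
    (set_val rB.2 : 'M[R]_n) @[rB --> qA] --> (set_val qA.2 : 'M[R]_n).
  move=> qA; apply: (@cvg_comp _ _ _ snd (fun B : GL => set_val B : 'M[R]_n)).
    exact: cvg_snd.
  exact: cvg_GLn.
apply: closed_eq_fun => qA; apply: cvgM.
- by apply: cq; rewrite !inE eqxx.
- by apply: cvg_entry; apply: cvg_invmx; [exact: cA|exact: GLn_unit].
- by apply: cq; rewrite !inE eqxx orbT.
- by apply: cvg_entry; exact: cA.
Qed.

(** Stability under products is adjoint_pairM for the pairs (A, A^-1) and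
    (A', A'^-1), because A'^-1 A^-1 is the inverse of A A'. *)
Lemma limit_closed_subgroup q : W q -> is_closed_subgroup (limit_set q).
Proof.
move=> Wq; have ra := pair_mx_ratio_matrix Wq; split.
- rewrite (_ : limit_set q = (fun A : GL => (q, A)) @^-1`
    [set qA : T * GL | limit_set qA.1 qA.2])//.
  apply: closed_comp => [A _|]; last exact: closed_incidence.
  exact: (@cvg_pair _ _ _ (nbhs A) _ _ _ _ _ (fun=> q) id
    (@cvg_cst _ q _ (nbhs A) _) cvg_id).
- by rewrite /limit_set /= invmx1; exact: adjoint_pair_scalar.
- move=> A B hA hB; rewrite /limit_set /= invmx_mulmx ?GLn_unit//.
  exact: adjoint_pairM.
- by move=> A hA; rewrite /limit_set /= invmxK; exact: adjoint_pairC.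
Qed.

Definition limit_group (q : W) : closed_subgroup GL :=
  SigSub (mem_set (limit_closed_subgroup (set_valP q))).

Lemma carrier_limit_group (q : W) : carrier (limit_group q) = limit_set (set_val q).
Proof. by []. Qed.

(** The incidence relation is closed and K is compact, so the points whose limit
    set meets K form a closed set. *)
Lemma limit_upper q (K : set GL) : compact K -> limit_set q `&` K = set0 ->
  \forall r \near q, limit_set r `&` K = set0.
Proof.
move=> /compact_near_coveringP cK qK.
have : \forall r \near q, K `<=` [set A | ~ limit_set r A].
  apply: (cK _ (nbhs q) (fun r A => ~ limit_set r A)) => A KA.
  have nA : ~ limit_set q A by move=> h; have : (limit_set q `&` K) A by []; rewrite qK.
  have : nbhs (A, q) (fun Aq : GL * T => ~ limit_set Aq.2 Aq.1).
    apply: (@swap_continuous GL T (A, q) [set qA : T * GL | ~ limit_set qA.1 qA.2]).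
    by apply: open_nbhs_nbhs; split => //; exact: (closed_openC closed_incidence).
  by [].
by apply: filterS => r h; rewrite -subset0 => A [rA /h].
Qed.

(** For A in the limit set of q and a suitable sign matrix E, the Cayley transform
    X of E A solves a_ij X_ij = - a_ji X_ji.  For r near q, it is moved to a
    solution Y r of the same equations for the ratios of r, and E times the
    Cayley transform of Y r is an element of the limit set of r near A. *)
Lemma limit_lower q (U : set GL) : W q -> open U -> limit_set q `&` U !=set0 ->
  \forall r \near q, W r -> limit_set r `&` U !=set0.
Proof.
move=> Wq [Q oO <-] [A [hA /= OA]].
have ra := pair_mx_ratio_matrix Wq.
set M := set_val A in hA OA.
have Mu : M \in unitmx by exact: GLn_unit.
have [e e1 eu] := sign_shift_unit M.
pose E : 'M[R]_n := diag_mx e.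
have EE : E *m E = 1%:M.
  apply/matrixP => i j; rewrite mul_diag_mx !mxE mulrnAr -expr2.
  by rewrite e1.
have Eu : E \in unitmx by case: (mulmx1_unit EE).
pose N := E *m M.
have Nu : N \in unitmx by rewrite unitmx_mul Eu.
have hN : adjoint_pair (pair_mx q) N (invmx N).
  rewrite invmx_mulmx//; have -> : invmx E = E by rewrite -[LHS]mulmx1 -EE mulKmx.
  by apply: adjoint_pairM => //; exact: adjoint_pair_diag.
have N1 : 1%:M + N \in unitmx by rewrite -EE -mulmxDr addrC unitmx_mul Eu.
have [] := cayleyK Nu N1.
have := cayley_adjoint_pair ra hN (mulmxV Nu) N1.
set X := (1%:M - N) *m _ => /= hX X1 X'1 XN; clearbody X.
(* The pair (Y_ij, Y_ji) is the orthogonal projection of (X_ij, X_ji) onto the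
   line of solutions, which is spanned by (r_j, - r_i) for r_i : r_j the ratio
   of r; the diagonal entries are 0. *)
pose Y r : 'M[R]_n := \matrix_(i, j) (X i j * rr r i j j j - X j i * rr r i j i j).
have hY r : adjoint_pair (pair_mx r) (Y r) (- Y r).
  move=> i j; rewrite (pair_mxE r i j) (pair_mxET r i j) !mxE (finset.setUC [set j]).
  by rewrite /coord_ratio; ring.
have Yq : Y q = X.
  apply/matrixP => i j; have := hX i j; rewrite (pair_mxE q i j) (pair_mxET q i j) !mxE.
  have J0 : [set i; j]%SET != finset.set0.
    by apply/set0Pn; exists i; rewrite !inE eqxx.
  have [k + uk] := factor_vector_neq0 q J0; rewrite !inE => kij.
  have [ij|ij] := eqVneq i j.
    move: kij uk; rewrite -ij orbb => /eqP-> ui; rewrite subrr mulrN => /eqP.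
    rewrite -subr_eq0 -opprD oppr_eq0 -mulr2n mulrn_eq0/= mulf_eq0 (negPf ui).
    by move=> /eqP->.
  have S0 := sumsq_neq0 (_ : k \in [set i; j]%SET) uk.
  move: {S0} (S0 (ltac:(by rewrite !inE))); rewrite /coord_ratio.
  have -> : \sum_(k in [set i; j]%SET) factor_vector q [set i; j]%SET 0 k ^+ 2 =
      factor_vector q [set i; j]%SET 0 i ^+ 2 + factor_vector q [set i; j]%SET 0 j ^+ 2.
    by rewrite big_setU1 ?inE//= big_set1.
  move: (factor_vector _ _ 0 i) (factor_vector _ _ 0 j) => x y S0 H.
  have -> : X i j * (y * y / (x ^+ 2 + y ^+ 2)) - X j i * (x * y / (x ^+ 2 + y ^+ 2)) =
     (X i j * y ^+ 2 - x * (y * X j i)) / (x ^+ 2 + y ^+ 2) by ring.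
  by rewrite -H; field.
have cY : Y r @[r --> q] --> X.
  rewrite -Yq; apply: cvg_mx => i j; rewrite mxE; under eq_cvg do rewrite mxE.
  have iJ : i \in [set i; j]%SET by rewrite !inE eqxx.
  have jJ : j \in [set i; j]%SET by rewrite !inE eqxx orbT.
  by apply: cvgB; (apply: cvgM; first exact: cvg_cst); exact: factor_ratio_continuous.
have c1 : (1%:M + Y r) @[r --> q] --> 1%:M + X by apply: cvgD => //; exact: cvg_cst.
have c2 : (1%:M - Y r) @[r --> q] --> 1%:M - X by apply: cvgB => //; exact: cvg_cst.
pose Z r := E *m ((1%:M - Y r) *m invmx (1%:M + Y r)).
have cZ : Z r @[r --> q] --> M.
  have -> : M = E *m ((1%:M - X) *m invmx (1%:M + X)).
    by rewrite XN /N mulmxA EE mul1mx.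
  apply: cvg_mulmx; first exact: cvg_cst.
  by apply: cvg_mulmx => //; exact: cvg_invmx.
have FF : Filter (nbhs q) by exact: nbhs_filter.
have u1 := near_unitmx FF c1 X1; have u2 := near_unitmx FF c2 X'1.
have uO : \forall r \near q, Q (Z r).
  by apply: cZ; exact: open_nbhs_nbhs.
apply: filterS3 u1 u2 uO => r Y1 Y2 OZ Wr.
have rr' := pair_mx_ratio_matrix Wr.
have [Cu hC] := cayley_inv_adjoint_pair rr' (hY r) Y1 Y2.
have Zu : Z r \in unitmx by rewrite unitmx_mul Eu.
exists (SigSub (mem_set (Zu : [set A : 'M[R]_n | A \in unitmx] (Z r)))); split=> //.
rewrite /limit_set /= /Z invmx_mulmx//.
have -> : invmx E = E by rewrite -[LHS]mulmx1 -EE mulKmx.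
by apply: adjoint_pairM => //; exact: adjoint_pair_diag.
Qed.

Lemma limit_group_continuous : continuous limit_group.
Proof.
move=> q; apply: (@cvg_chabauty _ _ (nbhs q) _ _ (nbhs_filter q)) => S hS.
  rewrite carrier_limit_group => /(limit_upper hS) h.
  exact: (nbhs_set_val h).
rewrite carrier_limit_group => /(limit_lower (set_valP q) hS)/nbhs_set_val.
by apply: filterS => r h; exact: h (set_valP r).
Qed.

(** An element of both groups whose entries (i, j) and (j, i) are not both 0
    forces the ratios of index i, j to be equal; planar_reflection supplies it. *)
Lemma limit_group_inj : injective limit_group.
Proof.
move=> q q' /(congr1 (@carrier _)); rewrite !carrier_limit_group => E.
apply: val_inj; apply: wonderful_eq; [exact: set_valP|exact: set_valP|].
move=> i j; have [->|ij] := eqVneq i j; first by rewrite mulrC.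
have [A [AA hA A0]] := planar_reflection (pair_mx_ratio_matrix (set_valP q)) ij.
have [Au _] := mulmx1_unit AA.
have AV : invmx A = A by rewrite -[LHS]mulmx1 -AA mulKmx.
pose B : GL := SigSub (mem_set (Au : [set A : 'M[R]_n | A \in unitmx] A)).
have qB : limit_set (set_val q) B by rewrite /limit_set /= AV.
have : limit_set (set_val q') B by rewrite -E.
move/(_ i j); rewrite /= AV => h'; have := hA i j => h.
apply: (@proportional_trans _ _ _ (A j i) (A i j)).
- by rewrite orbC.
- exact: h.
- by rewrite mulrC -h' mulrC.
Qed.

(** The equations of limit_set read D A^-1 = A^T D. *)
Lemma limit_group_torus (p : @arrangement_compl R n)
    (v : off_subspace (0%VS : {vspace V})) (Wp : W (torus_point p)) :
  line v = set_val p ->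
  limit_group (SigSub (mem_set Wp)) = orthogonal_group (diag_mx (set_val v)).
Proof.
move=> vp; apply: val_inj; apply/seteqP.
have key i j (x y : R) :
   pair_mx (torus_point p) i j * x = pair_mx (torus_point p) j i * y <->
   set_val v 0 i * x = set_val v 0 j * y.
  rewrite (pair_mxE _ i j) (pair_mxET _ i j).
  have J0 : [set i; j]%SET != finset.set0 by apply/set0Pn; exists i; rewrite !inE eqxx.
  have [c c0 E] := factor_vector_torus vp J0; rewrite !E ?inE ?eqxx ?orbT//.
  by rewrite -!mulrA; split=> [/(mulfI c0)|->].
have D (A : GL) : Defs.orthogonal (diag_mx (set_val v)) A <->
    diag_mx (set_val v) *m invmx (set_val A) = (set_val A)^T *m diag_mx (set_val v).
  have Au := GLn_unit A; split=> [h|h].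
    by rewrite -[in LHS]h mulmxK.
  by rewrite /Defs.orthogonal /= -h mulmxKV.
split=> A h.
  apply/D/matrixP => i j; rewrite mul_diag_mx mul_mx_diag !mxE [RHS]mulrC.
  exact/key.
move=> i j; apply/key; have /D/matrixP/(_ i j) := h.
by rewrite mul_diag_mx mul_mx_diag !mxE => ->; rewrite mulrC.
Qed.

End LimitGroups.

(** * Compactness and the homeomorphism *)

Lemma wonderful_compact (R : realType) n :
  compact (@wonderful_compactification R n).
Proof.
have c1 : compact [set: proj_space R n] by exact: proj_quot_compact (@cuts_out0 R n).
have c2 : compact [set: wonderful_factors R n].
  have := @tychonoff (@coord_lattice R n) (fun X => proj_quot (set_val X))
    (fun X => [set: proj_quot (set_val X)]).
  rewrite (_ : [set f | _] = setT); last by apply/seteqP; split.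
  apply=> X; have [I [_ XI _]] := factor_vector_lattice X.
  exact: proj_quot_compact XI.
apply: (@subclosed_compact _ _ (setT `*` setT)) => //.
- exact: closed_closure.
- exact: compact_setX.
Qed.

Section Image.
Variables (R : realType) (m : nat).
Local Notation n := m.+1.
Local Notation W := (@wonderful_compactification R n).
Local Notation D := (@diag_orthogonal_groups R n).

Lemma diag_unitmx (d : 'rV[R]_n) :
  (diag_mx d \in unitmx) = [forall i, d 0 i != 0].
Proof.
rewrite unitmxE det_diag unitfE.
by apply/prodf_neq0/forallP => h i; [exact: h|move=> _; exact: h].
Qed.

Lemma torus_in_wonderful (p : @arrangement_compl R n) : W (torus_point p).
Proof. by apply: subset_closure; exists p. Qed.

Definition wonderful_torus_point (p : @arrangement_compl R n) : W :=
  SigSub (mem_set (@torus_in_wonderful p)).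

Lemma limit_group_torus_diag (p : @arrangement_compl R n) :
  D (limit_group (wonderful_torus_point p)).
Proof.
have [v vp] := torus_vector p; rewrite (limit_group_torus _ vp).
have vu : diag_mx (set_val v) \in unitmx.
  rewrite diag_unitmx; apply/forallP => i; apply/negP => vi.
  by apply: (set_valP p); exists i => //; exists v; rewrite //= mem_coord_hyperplane.
exists (SigSub (mem_set (vu : [set A : 'M[R]_n | A \in unitmx] _))) => //=.
exact: diag_mx_is_diag.
Qed.

Lemma diag_limit_group H : D H -> exists q, limit_group q = H.
Proof.
move=> [A /= /is_diag_mxP Ad <-].
pose d : 'rV[R]_n := \row_i set_val A i i.
have AE : set_val A = diag_mx d.
  apply/matrixP => i j; rewrite !mxE; have [->|ij] := eqVneq i j.
    by rewrite mulr1n.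
  by rewrite mulr0n Ad.
have := GLn_unit A; rewrite AE diag_unitmx => /forallP dn.
have d0 : d \notin (0%VS : {vspace 'rV[R]_n}).
  by rewrite memv0; apply/negP => /eqP/rowP/(_ 0); apply/eqP; rewrite [X in _ != X]mxE.
pose v : off_subspace (0%VS : {vspace 'rV[R]_n}) :=
  SigSub (mem_set (d0 : off_subspace 0%VS d)).
have vp : arrangement_compl (line v : proj_space R n).
  move=> [i _ [w /= wi /lineP[c c0]]].
  rewrite memv0 subr_eq0 => /eqP wE; move: wi; rewrite mem_coord_hyperplane wE mxE.
  by rewrite mulf_eq0 (negPf c0) (negPf (dn i)).
pose p : @arrangement_compl R n := SigSub (mem_set vp).
exists (wonderful_torus_point p).
exact: (@limit_group_torus _ _ p v).
Qed.

(** The torus is dense in the compactification and limit_group is continuous. *)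
Lemma limit_group_closure (q : W) : closure D (limit_group q).
Proof.
move=> B /(@limit_group_continuous R m q) [_ [ [S oS <-] Sq SB]].
have [_ [ [p _ <-] Sp]] := set_valP q _ (open_nbhs_nbhs (conj oS Sq)).
exists (limit_group (wonderful_torus_point p)).
by split; [exact: limit_group_torus_diag|exact: SB].
Qed.

Lemma GLn_chabauty_hausdorff : hausdorff_space (closed_subgroup (GLn R n)).
Proof. by apply: chabauty_hausdorff; exact: GLn_locally_compact. Qed.

Lemma compact_wonderful_type : compact [set: W].
Proof.
have -> : [set: W] = set_val @^-1` W.
  by apply/seteqP; split=> // q _; exact: set_valP.
by apply: compact_set_val => //; exact: wonderful_compact.
Qed.

(** The image of limit_group is compact, hence closed, and contains the diagonal
    orthogonal groups. *)
Lemma closure_limit_group H : closure D H -> exists q, limit_group q = H.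
Proof.
have cl : closed (range (@limit_group R m)).
  apply: compact_closed; first exact: GLn_chabauty_hausdorff.
  apply: continuous_compact; last exact: compact_wonderful_type.
  by apply: continuous_subspaceT; exact: limit_group_continuous.
have sub : closure D `<=` range (@limit_group R m).
  rewrite (closure_id (range _)).1//; apply: closure_subset => L /diag_limit_group[q <-].
  by exists q.
by move=> /sub[q _ <-]; exists q.
Qed.

End Image.

Theorem mainTheorem2 (R : realType) (n : nat) (hn : (0 < n)%N) :
  homeomorphic (closure (@diag_orthogonal_groups R n))
               (@wonderful_compactification R n).
Proof.
case: n hn => [//|m] _.
pose g (q : @wonderful_compactification R m.+1) :
    closure (@diag_orthogonal_groups R m.+1) :=
  SigSub (mem_set (@limit_group_closure R m q)).
have /choice[f fE] (H : closure (@diag_orthogonal_groups R m.+1)) :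
    exists q, limit_group q = set_val H.
  exact: closure_limit_group (set_valP H).
have fg : cancel f g by move=> H; apply: val_inj; exact: fE.
have gf : cancel g f by move=> q; apply: limit_group_inj; exact: fE.
have cg : continuous g.
  by apply: continuous_comp_initial; exact: limit_group_continuous.
exists f, g; split=> //.
apply: (compact_inv_continuous (@compact_wonderful_type R m) _ cg) => //.
by apply: hausdorff_set_type; exact: GLn_chabauty_hausdorff.
Qed.
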